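(* Let $m\ge 1$ be an integer such that $m+1$ is not a perfect square, and suppose there exists a skew-Hadamard matrix $H$ of order $m+1$. Let $n\geq 1$ be an integer. Then there exists a morphism $\mathcal{H}(n,X_m)\rightarrow \mathcal{BH}(nm+n,2)$. Explicitly: there is an isomorphism of $\mathbb{Q}$-algebras $\varphi:\mathbb{Q}[\alpha_m]\to\mathbb{Q}\left[\tfrac{1}{\sqrt{m+1}}H\right]$ such that for every $M\in\mathcal{H}(n,X_m)$ the matrix $\sqrt{m+1}\,M^{\varphi}$ is a real Hadamard matrix of order $n(m+1)$, i.e. lies in $\mathcal{BH}(n(m+1),2)$.
   Context: For a set $X$ of complex numbers of modulus $1$, $\mathcal{H}(n,X)$ denotes the set of $n\times n$ matrices $M$ with all entries in $X$ satisfying $MM^{\ast}=nI_n$, where $M^{\ast}$ is the conjugate transpose. When $X$ is the set of all complex $k$-th roots of unity, $\mathcal{H}(n,X)$ is denoted $\mathcal{BH}(n,k)$; in particular $\mathcal{BH}(n,2)$ is the set of real Hadamard matrices of order $n$, i.e. $n\times n$ matrices with entries in $\{\pm 1\}$ and $MM^{\top}=nI_n$. $X_m=\left\{\frac{\pm 1\pm\sqrt{-m}}{\sqrt{m+1}}\right\}$ (all four choices of signs), and $\alpha_m=\frac{1+\sqrt{-m}}{\sqrt{m+1}}\in\mathbb{C}$. Elements of $\mathcal{H}(n,X_m)$ are called quaternary unit Hadamard (QUH) matrices. A real Hadamard matrix $H$ of order $m+1$ is called skew (a skew-Hadamard matrix) if $H-I$ is a skew-symmetric matrix. $\mathbb{Q}[\alpha_m]$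 is the $\mathbb{Q}$-subalgebra of $\mathbb{C}$ generated by $\alpha_m$, and $\mathbb{Q}\left[\frac{1}{\sqrt{m+1}}H\right]$ is the $\mathbb{Q}$-subalgebra of the algebra of real $(m+1)\times(m+1)$ matrices generated by $\frac{1}{\sqrt{m+1}}H$ (with unit $I_{m+1}$). For a matrix $M$ with entries in $\mathbb{Q}[\alpha_m]$, $M^{\varphi}$ denotes the block matrix obtained by replacing each entry $x$ of $M$ by the $(m+1)\times(m+1)$ block $\varphi(x)$. A morphism here means a map between sets of complex Hadamard matrices induced, up to the scalar normalisation $\sqrt{m+1}$, by applying such an algebra isomorphism entrywise. *)

(* Defs.v *)
From HB Require Import structures.
From mathcomp Require Export all_boot all_order all_algebra.
From mathcomp Require Export boolp classical_sets functions reals.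
From mathcomp Require Export complex mxtens.

Set Implicit Arguments.
Unset Strict Implicit.
Unset Printing Implicit Defensive.

Import Order.TTheory GRing.Theory Num.Theory.
Local Open Scope ring_scope.
Local Open Scope classical_set_scope.
Local Open Scope sesquilinear_scope.

Definition hadamard (C : numClosedFieldType) (n : nat) (X : set C) :
    set 'M[C]_n :=
  [set M : 'M[C]_n | (forall i j, X (M i j)) /\ M *m M ^t* = n%:R%:M].

Definition butson_hadamard (C : numClosedFieldType) (n k : nat) :
    set 'M[C]_n :=
  hadamard [set z : C | k.-unity_root z].

Definition real_hadamard (R : pzRingType) (n : nat) : set 'M[R]_n :=
  [set M : 'M[R]_n | (forall i j, M i j = 1 \/ M i j = -1) /\ M *m M^T = n%:R%:M].

Definition skew_hadamard (R : realType) (n : nat) : set 'M[R]_n :=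
  [set H : 'M[R]_n | real_hadamard H /\ H - 1%:M \is skewmx].

(* The booleans s and t range over the four choices of signs. *)
Definition quh_entries (C : numClosedFieldType) (m : nat) : set C :=
  [set z | exists s t : bool,
    z = ((-1) ^+ s + (-1) ^+ t * sqrtC (- m%:R)) / sqrtC m.+1%:R].

Definition quh_alpha (C : numClosedFieldType) (m : nat) : C :=
  (1 + sqrtC (- m%:R)) / sqrtC m.+1%:R.

(* The rings A below are only R[i] and square real matrices of positive size;
   there nonzero integers are invertible, so that [ratr] is the structure map
   of A as a Q-algebra. *)
Definition is_Qsubalgebra (A : unitRingType) (S : set A) : Prop :=
  [/\ S 1,
      forall x y, S x -> S y -> S (x + y),
      forall x y, S x -> S y -> S (x * y)
    & forall (q : rat) x, S x -> S (ratr q * x)].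

Definition Qalgebra_gen (A : unitRingType) (a : A) : set A :=
  smallest (@is_Qsubalgebra A) [set a].

(* An isomorphism S -> T is represented by a function on the ambient ring, of
   which only the restriction to S is constrained. *)
Definition is_Qalgebra_iso (A B : unitRingType) (S : set A) (T : set B)
    (phi : A -> B) : Prop :=
  [/\ set_bij S T phi,
      phi 1 = 1,
      forall x y, S x -> S y -> phi (x + y) = phi x + phi y,
      forall x y, S x -> S y -> phi (x * y) = phi x * phi y
    & forall (q : rat) x, S x -> phi (ratr q * x) = ratr q * phi x].

(* [mxtens_unindex] sends an index k < n * p to (k %/ p, k %% p), i.e. to the
   number of its block and its position inside that block. *)
Definition blockwise (A B : Type) (n p : nat) (phi : A -> 'M[B]_p)
    (M : 'M[A]_n) : 'M[B]_(n * p) :=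
  \matrix_(i, j) phi (M (mxtens_unindex i).1 (mxtens_unindex j).1)
                     (mxtens_unindex i).2 (mxtens_unindex j).2.

(* Main.v *)
From HB Require Import structures.
From mathcomp Require Import ring.
Require Import Defs.
Import Order.TTheory GRing.Theory Num.Theory.
Local Open Scope ring_scope.
Local Open Scope classical_set_scope.

(** Write H = 1 + S. Skewness and H H^T = m + 1 give S^2 = - m, so J = S / c with
c^2 = m satisfies J^2 = -1, and x + i y |-> x + y J is a ring morphism from the
complex numbers to real matrices turning conjugation into transposition. When
i c = sqrt(-m), it sends quh_alpha to H / sqrt(m+1), hence it restricts to an
isomorphism between the algebras these two elements generate, and it sends the
four elements of X_m to +-H / sqrt(m+1) and +-H^T / sqrt(m+1). *)

Lemma Qalgebra_genP (A : unitRingType) (a : A) :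
  is_Qsubalgebra (Qalgebra_gen a).
Proof.
split.
- by move=> T [[]].
- by move=> x y Sx Sy T TP; case: (TP) => -[_ + _ _] _; apply; [exact: Sx|exact: Sy].
- by move=> x y Sx Sy T TP; case: (TP) => -[_ _ + _] _; apply; [exact: Sx|exact: Sy].
- by move=> q x Sx T TP; case: (TP) => -[_ _ _ +] _; apply; exact: Sx.
Qed.

Lemma Qalgebra_gen_id (A : unitRingType) (a : A) : Qalgebra_gen a a.
Proof. exact: sub_gen_smallest. Qed.

(** [A] need not be a field: denominators are units of [F], and [f] carries inverses of units to
    inverses. *)
Lemma rmorph_ratr (F : numFieldType) (A : unitRingType) (f : {rmorphism F -> A})
  (q : rat) : f (ratr q) = ratr q.
Proof.
have d_unit : (denq q)%:~R \is a @GRing.unit F by rewrite unitfE intr_eq0 denq_eq0.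
by rewrite /ratr [LHS]rmorphM (rmorphV f) // !(rmorph_int f).
Qed.

(** Both inclusions between the image and the target come from minimality: the preimage of the
    algebra of [f a] is a subalgebra containing [a], and the image of the algebra of [a] is a
    subalgebra containing [f a]. Injectivity holds because [F] is a field. *)
Lemma rmorph_Qalgebra_iso (F : numFieldType) (A : unitRingType)
    (f : {rmorphism F -> A}) (a : F) :
  is_Qalgebra_iso (Qalgebra_gen a) (Qalgebra_gen (f a)) f.
Proof.
split; [split| exact: rmorph1 | by move=> x y _ _; exact: rmorphD
       | by move=> x y _ _; exact: rmorphM
       | by move=> q x _; rewrite rmorphM rmorph_ratr].
- have [g1 gD gM gZ] := Qalgebra_genP _ (f a).
  apply: (@smallest_sub _ _ _ (f @^-1` Qalgebra_gen (f a))).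
    split=> [|x y Sx Sy|x y Sx Sy|q x Sx] /=.
    - by rewrite rmorph1.
    - by rewrite rmorphD; exact: gD.
    - by rewrite rmorphM; exact: gM.
    - by rewrite rmorphM rmorph_ratr; exact: gZ.
  by move=> _ ->; exact: Qalgebra_gen_id.
- by move=> x y _ _; exact: fmorph_inj.
- have [g1 gD gM gZ] := Qalgebra_genP _ a.
  apply: (@smallest_sub _ _ _ (f @` Qalgebra_gen a)).
    split=> [|_ _ [x Sx <-] [y Sy <-]|_ _ [x Sx <-] [y Sy <-]|q _ [x Sx <-]].
    - by exists 1; rewrite ?rmorph1.
    - by exists (x + y); [exact: gD|rewrite rmorphD].
    - by exists (x * y); [exact: gM|rewrite rmorphM].
    - by exists (ratr q * x); [exact: gZ|rewrite rmorphM rmorph_ratr].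
  by move=> _ ->; exists a => //; exact: Qalgebra_gen_id.
Qed.

(** The proof [J2] is an argument so that the morphism structures below can be attached to the
    function [complex_alg J2] itself. *)
Definition complex_alg {R : rcfType} {A : algType R} {J : A} (J2 : J * J = -1)
  (z : R[i]) : A := (complex.Re z)%:A + complex.Im z *: J.

Lemma complex_alg_is_zmod_morphism (R : rcfType) (A : algType R) (J : A)
  (J2 : J * J = -1) : zmod_morphism (complex_alg J2).
Proof.
move=> [a b] [c d]; rewrite /complex_alg /= !scalerDl !scaleNr opprD.
by rewrite addrACA.
Qed.

Lemma complex_alg_is_monoid_morphism (R : rcfType) (A : algType R) (J : A)
  (J2 : J * J = -1) : monoid_morphism (complex_alg J2).
Proof.
split=> [|[a b] [c d]]; rewrite /complex_alg /= ?scale1r ?scale0r ?addr0 //.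
rewrite mulrDl !mulrDr -!scalerAl -!scalerAr !mul1r mulr1 J2 !scalerA.
rewrite scalerN !scalerDl scaleNr -!addrA; congr (_ + _).
by rewrite addrC addrA.
Qed.

HB.instance Definition _ (R : rcfType) (A : algType R) (J : A) (J2 : J * J = -1) :=
  GRing.isZmodMorphism.Build R[i] A (complex_alg J2)
    (complex_alg_is_zmod_morphism R A J J2).
HB.instance Definition _ (R : rcfType) (A : algType R) (J : A) (J2 : J * J = -1) :=
  GRing.isMonoidMorphism.Build R[i] A (complex_alg J2)
    (complex_alg_is_monoid_morphism R A J J2).

Lemma conjC_complex (R : rcfType) (z : R[i]) : Num.conj z = conjc z.
Proof. by []. Qed.

(** Conjugation flips the sign of the imaginary part, just as transposition flips the sign of
    [J]. *)
Lemma complex_alg_conj (R : rcfType) (p : nat) (J : 'M[R]_p.+1)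
    (J2 : J * J = -1) (z : R[i]) :
  J^T = - J -> complex_alg J2 (Num.conj z) = (complex_alg J2 z)^T.
Proof.
move=> JT; rewrite conjC_complex; case: z => a b.
by rewrite /complex_alg /= linearD /= !linearZ /= JT trmx1 scaleNr scalerN.
Qed.

Lemma blockwise_mulmx (A : pzSemiRingType) (B : nzRingType) (n p : nat)
    (f : {rmorphism A -> 'M[B]_p.+1}) (M N : 'M[A]_n) :
  blockwise f M *m blockwise f N = blockwise f (M *m N).
Proof.
apply/matrixP=> i k; rewrite !mxE rmorph_sum summxE.
under [RHS]eq_bigr => j _ do rewrite rmorphM mxE.
(* Summing over an index of the big product is summing over a block and a position inside it. *)
rewrite pair_big (reindex (@mxtens_index n p.+1)) /=; last first.
  by exists (@mxtens_unindex n p.+1) => j _;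
    [exact: mxtens_indexK|exact: mxtens_unindexK].
by apply: eq_bigr => -[j1 j2] _; rewrite !mxE mxtens_indexK.
Qed.

Lemma blockwise_scalar (A : pzSemiRingType) (B : nzRingType) (n p : nat)
    (f : {rmorphism A -> 'M[B]_p.+1}) (k : nat) :
  blockwise f (k%:R%:M : 'M[A]_n) = k%:R%:M.
Proof.
apply/matrixP=> i j; case: (mxtens_indexP i) => i1 i2.
case: (mxtens_indexP j) => j1 j2; rewrite !mxE !mxtens_indexK /= rmorphMn rmorph_nat.
rewrite (can_eq (@mxtens_indexK _ _)) xpair_eqE.
case: eqP => _ /=; last by rewrite !mulr0n mxE.
by rewrite mulr1n -(scaler_nat k 1) scalemx1 mxE.
Qed.

Lemma real_hadamard_butson (R : rcfType) (n : nat) (M : 'M[R]_n) :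
  real_hadamard M -> butson_hadamard 2 (map_mx (real_complex R) M).
Proof.
move=> [M1 MM]; split=> [i j /=|].
  rewrite unity_rootE mxE -rmorphXn.
  by case: (M1 i j) => ->; rewrite ?sqrrN expr1n rmorph1.
have -> : map_mx Num.conj (map_mx (real_complex R) M)^T =
          map_mx (real_complex R) M^T.
  by apply/matrixP=> i j; rewrite !mxE conjC_complex conjc_real.
by rewrite -map_mxM MM map_scalar_mx rmorph_nat.
Qed.

(** With S = H - 1 skew, H^T = 1 - S, so p + 1 = H H^T = (1 + S)(1 - S) = 1 - S^2. *)
Lemma skew_hadamard_core (R : realType) (p : nat) (H : 'M[R]_p.+1) :
  skew_hadamard H ->
  (H - 1)^T = - (H - 1) /\ (H - 1) * (H - 1) = - p%:R.
Proof.
move=> [[_ HH] /is_hermitianmxP HS].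
have ST : (H - 1)^T = - (H - 1).
  (* [skewmx] is the hermitian condition with sign -1 and the identity as conjugation. *)
  rewrite [in RHS]HS expr1 scaleN1r opprK; apply/matrixP=> i j.
  by rewrite !mxE.
split=> //; set S := H - 1 in ST *.
have {}HH : (1 + S) * (1 - S) = p.+1%:R.
  rewrite -[RHS]scaler_nat scalemx1 -HH; congr (_ *m _); first by rewrite addrC subrK.
  by rewrite -ST -[1 in LHS]trmx1 -linearD /= addrC subrK.
move: HH; rewrite mulrBr mulr1 mulrDl mul1r opprD addrA addrK -nat1r.
by move=> /addrI <-; rewrite opprK.
Qed.

Lemma sqrtC_natE (R : rcfType) (k : nat) :
  sqrtC k%:R = real_complex R (Num.sqrt k%:R).
Proof.
apply/eqP; rewrite -(@eqrXn2 _ 2) ?sqrtC_ge0 ?ler0n ?ler0c ?sqrtr_ge0 //.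
by rewrite sqrtCK -rmorphXn sqr_sqrtr ?ler0n //= rmorph_nat.
Qed.

(** The sign of c is left open, so nothing later depends on which root [sqrtC] picks. *)
Lemma sqrtCN_natE (R : rcfType) (k : nat) :
  exists2 c : R, c ^+ 2 = k%:R & sqrtC (- k%:R) = Complex 0 c.
Proof.
have := sqrtCK (- k%:R : R[i]); case: (sqrtC _) => a b.
rewrite -[k%:R in RHS](rmorph_nat (real_complex R)) expr2 => -[re im].
have a0 : a = 0.
  (* If a were nonzero, the imaginary part 2ab = 0 would give b = 0, and then -k = a^2 > 0. *)
  apply/eqP; apply: contraTT (ler0n R k) => a_neq0.
  have b0 : b = 0.
    apply/eqP; have /eqP : a * b *+ 2 = 0 by rewrite mulr2n {2}[a * b]mulrC im oppr0.
    by rewrite mulrn_eq0 mulf_eq0 (negPf a_neq0).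
  rewrite -ltNge -oppr_gt0 -re b0 mulr0 subr0 -expr2.
  by rewrite exprn_even_gt0.
exists b; rewrite ?a0 //.
by apply: oppr_inj; rewrite -re a0 mul0r sub0r expr2.
Qed.

Lemma conjC_quh_alpha (R : rcfType) (m : nat) :
  Num.conj (quh_alpha R[i] m) = (1 - sqrtC (- m%:R)) / sqrtC m.+1%:R.
Proof.
rewrite /quh_alpha rmorphM fmorphV rmorphD rmorph1.
have [c _ ->] := sqrtCN_natE R m.
rewrite sqrtC_natE /= !conjC_complex conjc_real; congr ((_ + _) / _).
by apply/eqP; rewrite eq_complex /= oppr0 !eqxx.
Qed.

(** The sign [s] factors out; what remains is [quh_alpha] when [s] and [t] agree, and its conjugate
    when they differ. *)
Lemma quh_entriesP (R : rcfType) (m : nat) (z : R[i]) :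
  quh_entries m z ->
  [\/ z = quh_alpha _ m, z = - quh_alpha _ m, z = Num.conj (quh_alpha _ m)
    | z = - Num.conj (quh_alpha _ m)].
Proof.
move=> [s [t ->]]; rewrite conjC_quh_alpha /quh_alpha -!mulNr !opprD opprK.
case: s t => [] []; rewrite ?expr0 ?expr1 ?mulN1r ?mul1r.
- exact: Or42.
- exact: Or44.
- exact: Or43.
- exact: Or41.
Qed.

(* As a a^* = 1, multiply (a + a^* )^2 = 4 / (m + 1) by a and solve for a^*. *)
Lemma conjC_quh_alphaE (R : rcfType) (m : nat) (a := quh_alpha R[i] m) :
  Num.conj a = ratr (4 / m.+1%:R - 2) * a + ratr (-1) * (a * (a * a)).
Proof.
have r2 := sqrtCK (m.+1%:R : R[i]); have w2 := sqrtCK (- m%:R : R[i]).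
have r0 : sqrtC (m.+1%:R : R[i]) != 0 by rewrite sqrtC_eq0 pnatr_eq0.
rewrite conjC_quh_alpha /a /quh_alpha rmorphB fmorph_div !rmorph_nat rmorphN1.
rewrite -[X in 4 / X]r2.
have {}r2 : sqrtC m.+1%:R ^+ 2 = 1 - sqrtC (- m%:R) ^+ 2 :> R[i].
  by rewrite r2 w2 opprK -natr1 addrC.
set r := sqrtC _ in r0 r2 *; set w := sqrtC _ in r2 *.
rewrite mulN1r; field: r2; exact: r0.
Qed.

(** This places the entries of M in the domain of the isomorphism. The only entries that need an
    argument beyond signs are the conjugates, and [conjC_quh_alphaE] writes them as rational
    polynomials in [quh_alpha]. *)
Lemma Qalgebra_gen_quh_entries (R : rcfType) (m : nat) (z : R[i]) :
  quh_entries m z -> Qalgebra_gen (quh_alpha _ m) z.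
Proof.
set a := quh_alpha _ m; have [_ gD gM gZ] := Qalgebra_genP R[i] a.
have ga : Qalgebra_gen a a by exact: Qalgebra_gen_id.
have gN x : Qalgebra_gen a x -> Qalgebra_gen a (- x).
  by move=> gx; rewrite -mulN1r -(rmorphN1 (@ratr R[i])); exact: gZ.
have gc : Qalgebra_gen a (Num.conj a).
  rewrite conjC_quh_alphaE -/a; apply: gD; apply: gZ => //.
  exact: (gM _ _ ga (gM _ _ ga ga)).
by move=> /quh_entriesP[] ->; rewrite -/a //; exact: gN.
Qed.

Lemma complex_alg_quh_alpha (R : rcfType) (m : nat) (A : algType R) (J : A)
    (J2 : J * J = -1) (c : R) :
  sqrtC (- m%:R) = Complex 0 c ->
  complex_alg J2 (quh_alpha R[i] m) = (Num.sqrt m.+1%:R)^-1 *: (1 + c *: J).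
Proof.
move=> wc; set s := Num.sqrt _.
have -> : quh_alpha R[i] m = Complex s^-1 (s^-1 * c).
  rewrite /quh_alpha wc sqrtC_natE -/s -fmorphV mulrC.
  by apply/eqP; rewrite eq_complex /= addr0 add0r mulr1 !mul0r subr0 addr0 !eqxx.
by rewrite /complex_alg /= scalerDr scalerA.
Qed.

Lemma blockwise_hadamard (R : rcfType) (n p : nat) (X : set R[i])
    (f : {rmorphism R[i] -> 'M[R]_p.+1}) (s : R) (M : 'M[R[i]]_n) :
  s ^+ 2 = p.+1%:R ->
  (forall z, f (Num.conj z) = (f z)^T) ->
  (forall z, X z -> forall i j, s * f z i j = 1 \/ s * f z i j = -1) ->
  hadamard X M -> real_hadamard (s *: blockwise f M).
Proof.
move=> s2 fconj fX [MX MM]; split=> [i j|].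
  by rewrite !mxE; exact: fX.
(* Transposing swaps the blocks and transposes each one; by [fconj] the latter amounts to
   conjugating the entry of M. The Gram matrix is then s^2 times the blockwise image of M M^*. *)
have -> : (s *: blockwise f M)^T = s *: blockwise f (map_mx Num.conj M^T).
  by apply/matrixP=> i j; rewrite !mxE fconj mxE.
rewrite -scalemxAl -scalemxAr blockwise_mulmx MM blockwise_scalar scalerA.
by rewrite -expr2 s2 scale_scalar_mx -natrM mulnC.
Qed.

Theorem theorem4 (R : realType) (m n : nat) (H : 'M[R]_m.+1)
    (m_gt0 : (0 < m)%N)
    (m1_nonsquare : ~ exists s : nat, (m.+1 = s ^ 2)%N)
    (H_skew : skew_hadamard H)
    (n_gt0 : (0 < n)%N) :
  exists phi : R[i] -> 'M[R]_m.+1,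
    is_Qalgebra_iso (Qalgebra_gen (quh_alpha R[i] m))
      (Qalgebra_gen ((Num.sqrt m.+1%:R)^-1 *: H)) phi /\
    forall M : 'M[R[i]]_n, hadamard (@quh_entries R[i] m) M ->
      [/\ forall i j, Qalgebra_gen (quh_alpha R[i] m) (M i j),
          real_hadamard (Num.sqrt m.+1%:R *: blockwise phi M)
        & butson_hadamard 2
            (map_mx (real_complex R) (Num.sqrt m.+1%:R *: blockwise phi M))].
Proof.
have [ST S2] := skew_hadamard_core R m H H_skew; have [[H1 _] _] := H_skew.
set S := H - 1 in ST S2; set s := Num.sqrt _.
have [c c2 wc] := sqrtCN_natE R m.
(* Positivity of m makes c invertible, so that S can be normalised to a square root of -1. *)
have c0 : c != 0 by rewrite -sqrf_eq0 c2 pnatr_eq0 -lt0n.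
have J2 : (c^-1 *: S) * (c^-1 *: S) = -1.
  rewrite -scalerAl -scalerAr S2 scalerA -invfM -expr2 c2 scalerN.
  by rewrite -(scaler_nat m 1) scalerA mulVf ?scale1r // pnatr_eq0 -lt0n.
have JT : (c^-1 *: S)^T = - (c^-1 *: S) by rewrite linearZ /= ST scalerN.
have phi_alpha : complex_alg J2 (quh_alpha R[i] m) = s^-1 *: H.
  by rewrite (complex_alg_quh_alpha _ _ _ _ J2 c) //
    scalerA divff // scale1r addrC subrK.
exists (complex_alg J2); split.
  by rewrite -phi_alpha; exact: rmorph_Qalgebra_iso.
move=> M MH.
have s0 : s != 0 by rewrite gt_eqF // sqrtr_gt0 ltr0Sn.
have RH : real_hadamard (s *: blockwise (complex_alg J2) M).
  apply: blockwise_hadamard MH => [|z|z Xz i j].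
  - by rewrite sqr_sqrtr ?ler0n.
  - exact: complex_alg_conj.
  (* The factor s cancels the one in s^-1 H, leaving a signed entry of H or, for conjugates, of H^T;
     hence the cases on both [H i j] and [H j i]. *)
  have [Ha|Ha] := H1 i j; have [Hb|Hb] := H1 j i;
    case: (quh_entriesP _ _ _ Xz) => ->;
    rewrite ?rmorphN /= ?(complex_alg_conj _ _ _ J2) // phi_alpha !mxE ?mulrN mulVKf //;
    by rewrite ?Ha ?Hb ?opprK; tauto.
split=> [i j||]; [|exact: RH|exact: real_hadamard_butson].
by apply: Qalgebra_gen_quh_entries; case: MH => + _; exact.
Qed.
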